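(* Let $R$ be an associative ring with unit, let $n>0$ be an integer, let $I$ be an injective cogenerator of the category of left $R$-modules, and let $$\mathcal{I}=\Big\{\prod_{h\in \mathrm{Hom}_R(M,I)} I_h \;:\; I_h=I,\ M \text{ a left } R\text{-module}\Big\}.$$ The following are equivalent. (1) $R$ is left $n$-coherent. (2) $\mathrm{Ext}^n_R(M,X)=0$ for all $M\in\mathcal{FP}_n$ and all $X\in\varinjlim\mathcal{I}$. (3) $\Omega^{-n+1}(\varinjlim\mathcal{I})\subseteq \mathcal{FP}_n\text{-}\mathrm{Inj}$.
   Context: All modules are left $R$-modules. For an integer $n\ge 0$, a module $F$ is finitely $n$-presented if there is an exact sequence $F_n\to F_{n-1}\to\cdots\to F_0\to F\to 0$ with each $F_i$ finitely generated free (equivalently projective); $\mathcal{FP}_n$ is the class of all such modules. $R$ is left $n$-coherent if $\mathcal{FP}_n\subseteq\mathcal{FP}_{n+1}$. $\mathcal{FP}_n\text{-}\mathrm{Inj}$ is the class of modules $N$ with $\mathrm{Ext}^1_R(F,N)=0$ for all $F\in\mathcal{FP}_n$. For a class $\mathcal{A}$ of modules, $\varinjlim\mathcal{A}$ denotes the class of modules which are direct limits of direct systems of modules in $\mathcal{A}$, and $\Omega^{-i}(\mathcal{A})$ denotes the class of all $i$-th cosyzygies of injective coresolutions of modules in $\mathcal{A}$ (the $0$-th cosyzygy of a module being the module itself). *)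

(* Defs.v *)
(* MathComp, with the classical layer of MathComp-Analysis: it makes
   [lmodType R] range over all left R-modules (every type is classically a
   [choiceType]) and puts the pointwise module structure on function types. *)
From HB Require Import structures.
From mathcomp Require Import all_boot all_order all_algebra.
From mathcomp Require Import boolp functions.
Set Implicit Arguments.
Unset Strict Implicit.
Unset Printing Implicit Defensive.
Import Order.TTheory GRing.Theory.
Local Open Scope ring_scope.

(* Classes of modules; all those below are closed under isomorphism. *)
Definition mod_class (R : pzRingType) := lmodType R -> Prop.

Definition subclass (R : pzRingType) (A B : mod_class R) : Prop :=
  forall M : lmodType R, A M -> B M.

Definition lmod_iso (R : pzRingType) (M N : lmodType R) : Prop :=
  exists f : {linear M -> N}, bijective f.

Definition surjective (A B : Type) (f : A -> B) : Prop :=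
  forall y : B, exists x : A, f x = y.

Definition exact_at (R : pzRingType) (A B C : lmodType R)
    (f : {linear A -> B}) (g : {linear B -> C}) : Prop :=
  forall y : B, g y = 0 <-> exists x : A, f x = y.

Definition projective_module (R : pzRingType) (P : lmodType R) : Prop :=
  forall (A B : lmodType R) (p : {linear A -> B}) (f : {linear P -> B}),
    surjective p -> exists g : {linear P -> A}, forall x : P, p (g x) = f x.

Definition injective_module (R : pzRingType) (E : lmodType R) : Prop :=
  forall (A B : lmodType R) (u : {linear A -> B}) (f : {linear A -> E}),
    injective u -> exists g : {linear B -> E}, forall x : A, g (u x) = f x.

(* The functor Hom(-, I) is faithful. *)
Definition cogenerator (R : pzRingType) (I : lmodType R) : Prop :=
  forall (A B : lmodType R) (f g : {linear A -> B}),
    ~ (f =1 g) -> exists h : {linear B -> I}, ~ (h \o f =1 h \o g).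

Definition fg_free (R : pzRingType) (F : lmodType R) : Prop :=
  exists k : nat, lmod_iso F ('rV[R]_k : lmodType R).

(* F n -> F n.-1 -> ... -> F 0 -> M -> 0 is exact; the terms F i and the maps
   d j with n < i and n <= j are irrelevant. *)
Definition FP (R : pzRingType) (n : nat) : mod_class R := fun M =>
  exists (F : nat -> lmodType R) (d : forall i, {linear F i.+1 -> F i})
         (e : {linear F 0 -> M}),
    [/\ forall i, (i <= n)%N -> fg_free (F i),
        surjective e,
        (0 < n)%N -> exact_at (d 0) e
      & forall i, (i.+1 < n)%N -> exact_at (d i.+1) (d i)].

Definition left_coherent (R : pzRingType) (n : nat) : Prop :=
  subclass (@FP R n) (@FP R n.+1).

Record projective_resolution (R : pzRingType) (M : lmodType R) := {
  pr_obj :> nat -> lmodType R;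
  pr_d : forall i, {linear pr_obj i.+1 -> pr_obj i};
  pr_aug : {linear pr_obj 0 -> M};
  pr_proj : forall i, projective_module (pr_obj i);
  pr_aug_surj : surjective pr_aug;
  pr_exact0 : exact_at (pr_d 0) pr_aug;
  pr_exact : forall i, exact_at (pr_d i.+1) (pr_d i) }.

Definition is_cocycle (R : pzRingType) (M X : lmodType R)
    (P : projective_resolution M) (n : nat) (f : {linear P n -> X}) : Prop :=
  forall x : P n.+1, f (pr_d P n x) = 0.

Definition is_coboundary (R : pzRingType) (M X : lmodType R)
    (P : projective_resolution M) (n : nat) : {linear P n -> X} -> Prop :=
  match n with
  | 0 => fun f => forall x, f x = 0
  | m.+1 => fun f => exists g : {linear P m -> X}, forall x, f x = g (pr_d P m x)
  end.

(* Ext^n_R(M, X) = 0: the n-th cohomology ker / im of the complex Hom_R(P, X)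
   vanishes. Ext being independent of the projective resolution P of M, the
   condition is imposed for all of them. *)
Definition Ext_zero (R : pzRingType) (n : nat) (M X : lmodType R) : Prop :=
  forall (P : projective_resolution M) (f : {linear P n -> X}),
    is_cocycle f -> is_coboundary f.

Definition FP_Inj (R : pzRingType) (n : nat) : mod_class R := fun N =>
  forall F : lmodType R, FP n F -> Ext_zero 1 F N.

Definition directed (d : Order.disp_t) (J : porderType d) : Prop :=
  inhabited J /\ forall i j : J, exists k : J, (i <= k)%O /\ (j <= k)%O.

Record direct_system (R : pzRingType) (d : Order.disp_t) (J : porderType d) := {
  ds_obj :> J -> lmodType R;
  ds_map : forall i j : J, (i <= j)%O -> {linear ds_obj i -> ds_obj j};
  ds_map_id : forall (i : J) (le_ii : (i <= i)%O) (x : ds_obj i),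
    ds_map le_ii x = x;
  ds_map_comp : forall (i j k : J) (le_ij : (i <= j)%O) (le_jk : (j <= k)%O)
      (le_ik : (i <= k)%O) (x : ds_obj i),
    ds_map le_jk (ds_map le_ij x) = ds_map le_ik x }.

Definition is_cocone (R : pzRingType) (d : Order.disp_t) (J : porderType d)
    (S : direct_system R J) (Y : lmodType R)
    (c : forall i, {linear S i -> Y}) : Prop :=
  forall (i j : J) (le_ij : (i <= j)%O) (x : S i),
    c j (ds_map S le_ij x) = c i x.

Definition is_direct_limit (R : pzRingType) (d : Order.disp_t)
    (J : porderType d) (S : direct_system R J) (X : lmodType R) : Prop :=
  exists c : forall i, {linear S i -> X},
    is_cocone c /\
    forall (Y : lmodType R) (c' : forall i, {linear S i -> Y}),
      is_cocone c' ->
      exists h : {linear X -> Y},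
        (forall (i : J) (x : S i), h (c i x) = c' i x) /\
        forall h' : {linear X -> Y},
          (forall (i : J) (x : S i), h' (c i x) = c' i x) -> h' =1 h.

Definition dirlim (R : pzRingType) (A : mod_class R) : mod_class R := fun X =>
  exists (d : Order.disp_t) (J : porderType d) (S : direct_system R J),
    [/\ directed J, forall i : J, A (S i) & is_direct_limit S X].

Record injective_coresolution (R : pzRingType) (X : lmodType R) := {
  ic_obj :> nat -> lmodType R;
  ic_d : forall i, {linear ic_obj i -> ic_obj i.+1};
  ic_aug : {linear X -> ic_obj 0};
  ic_inj : forall i, injective_module (ic_obj i);
  ic_aug_inj : injective ic_aug;
  ic_exact0 : exact_at ic_aug (ic_d 0);
  ic_exact : forall i, exact_at (ic_d i) (ic_d i.+1) }.

(* The cosyzygy of index i.+1 is the image of E i -> E i.+1; C is isomorphic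
   to it iff C embeds in E i.+1 with that image. *)
Definition is_cosyzygy (R : pzRingType) (X : lmodType R)
    (E : injective_coresolution X) (i : nat) (C : lmodType R) : Prop :=
  match i with
  | 0 => lmod_iso C X
  | j.+1 => exists u : {linear C -> E j.+1},
      injective u /\
      forall y : E j.+1, (exists c : C, u c = y) <-> (exists x, ic_d E j x = y)
  end.

(* cosyzygies i A is the class $\Omega^{-i}(A)$. *)
Definition cosyzygies (R : pzRingType) (i : nat) (A : mod_class R) :
    mod_class R := fun C =>
  exists (X : lmodType R) (E : injective_coresolution X),
    A X /\ is_cosyzygy E i C.

(* The product of copies of I indexed by Hom_R(M, I) is the module of
   functions {linear M -> I} -> I. *)
Definition hom_powers (R : pzRingType) (I : lmodType R) : mod_class R :=
  fun Y => exists M : lmodType R,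
    lmod_iso Y (({linear M -> I} -> I) : lmodType R).

(* Main.v *)
(* For (1) => (2), take M in FP_n, hence in FP_(n+1), and a presentation
   F_(n+1) -> ... -> F_0 -> M by finitely generated free modules. A cocycle
   F_n -> X = lim E_j with E_j injective lifts to some E_j; finite generation
   of F_(n+1) makes the lift a cocycle for j large, and it then extends along
   F_n -> F_(n-1) because E_j is injective.

   For (2) => (1), dimension shifting reduces the claim to n = 1, that is, to
   the finite generation of the kernel L of F_1 -> K, where K is the first
   syzygy, contained in F_0. L is the directed union of its finitely generated
   submodules A. The embedding of N into I^Hom(N, I) is functorial in N, so
   K = lim F_1/A maps to X = lim I^Hom(F_1/A, I). By (2) this map extends to
   F_0, where it factors through some stage; comparing with F_1 -> F_1/A at a
   later stage A gives L = A.

   (2) <=> (3) is dimension shifting along an injective coresolution of X. It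
   is done inside each projective resolution of M separately, so independence
   of the resolution is only needed for Ext^1. *)
Require Import Defs.
From HB Require Import structures.
From mathcomp Require Import all_boot all_order all_algebra.
From mathcomp Require Import boolp functions.
Set Implicit Arguments.
Unset Strict Implicit.
Unset Printing Implicit Defensive.
Import Order.TTheory GRing.Theory.
Local Open Scope ring_scope.

(** * Modules from setoids *)

Definition linear_map (R : pzRingType) (M N : lmodType R) (f : M -> N)
    (f_lin : linear f) : {linear M -> N} :=
  HB.pack f (GRing.isLinear.Build R M N *:%R f f_lin).

Lemma linear_mapE (R : pzRingType) (M N : lmodType R) (f : M -> N)
  (f_lin : linear f) : linear_map f_lin =1 f.
Proof. by []. Qed.

(** Linearity is a proposition, so proof irrelevance upgrades pointwise equality. This matters once
    linear maps serve as indices of a product. *)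
Lemma linear_eq (R : pzRingType) (M N : lmodType R) (f g : {linear M -> N}) :
  f =1 g -> f = g.
Proof.
case: f g => [f [[f1] [f2]]] [g [[g1] [g2]]] /= /funext fg; subst g.
by congr GRing.Linear.Pack; congr GRing.Linear.Class; congr (_ _);
  apply: Prop_irrelevance.
Qed.

(* Quotients, submodules, free modules and direct limits are all built from
   modules up to an equivalence relation; the opposite is scaling by -1. *)
Record setoid_module (R : pzRingType) := {
  sm_car :> Type;
  sm_eq : sm_car -> sm_car -> Prop;
  sm_zero : sm_car;
  sm_add : sm_car -> sm_car -> sm_car;
  sm_scale : R -> sm_car -> sm_car;
  sm_refl : forall x, sm_eq x x;
  sm_sym : forall x y, sm_eq x y -> sm_eq y x;
  sm_trans : forall x y z, sm_eq x y -> sm_eq y z -> sm_eq x z;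
  sm_add_eq : forall x x' y y',
    sm_eq x x' -> sm_eq y y' -> sm_eq (sm_add x y) (sm_add x' y');
  sm_scale_eq : forall a x x',
    sm_eq x x' -> sm_eq (sm_scale a x) (sm_scale a x');
  sm_addA : forall x y z, sm_eq (sm_add x (sm_add y z)) (sm_add (sm_add x y) z);
  sm_addC : forall x y, sm_eq (sm_add x y) (sm_add y x);
  sm_add0 : forall x, sm_eq (sm_add sm_zero x) x;
  sm_addN : forall x, sm_eq (sm_add (sm_scale (-1) x) x) sm_zero;
  sm_scaleA : forall a b x,
    sm_eq (sm_scale a (sm_scale b x)) (sm_scale (a * b) x);
  sm_scale1 : forall x, sm_eq (sm_scale 1 x) x;
  sm_scaleDr : forall a x y,
    sm_eq (sm_scale a (sm_add x y)) (sm_add (sm_scale a x) (sm_scale a y));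
  sm_scaleDl : forall a b x,
    sm_eq (sm_scale (a + b) x) (sm_add (sm_scale a x) (sm_scale b x)) }.

(** A point is an equivalence class taken as a predicate, so that equality of points follows from
    extensionality; representatives are then picked by choice. *)
Definition setoid_quot (R : pzRingType) (T : setoid_module R) : Type :=
  {A : T -> Prop | exists t, A = sm_eq t}.

HB.instance Definition _ (R : pzRingType) (T : setoid_module R) :=
  gen_eqMixin (setoid_quot T).
HB.instance Definition _ (R : pzRingType) (T : setoid_module R) :=
  gen_choiceMixin (setoid_quot T).

Definition setoid_class (R : pzRingType) (T : setoid_module R) (t : T) :
    setoid_quot T :=
  exist _ (sm_eq t) (ex_intro _ t erefl).

Definition setoid_repr (R : pzRingType) (T : setoid_module R)
    (q : setoid_quot T) : T :=
  sval (cid (svalP q)).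

Lemma setoid_classP (R : pzRingType) (T : setoid_module R) (t u : T) :
  setoid_class t = setoid_class u <-> sm_eq t u.
Proof.
split=> [[tu]|tu]; first by rewrite tu; apply: sm_refl.
apply/eq_exist/funext => v; apply/propext; split=> h.
  by apply: sm_trans h; apply: sm_sym.
exact: sm_trans h.
Qed.

Lemma setoid_reprK (R : pzRingType) (T : setoid_module R) :
  cancel (@setoid_repr R T) (@setoid_class R T).
Proof.
by move=> [A ex_t]; apply/eq_exist; rewrite /setoid_repr /=; case: cid.
Qed.

Lemma sm_eq_repr (R : pzRingType) (T : setoid_module R) (t : T) :
  sm_eq (setoid_repr (setoid_class t)) t.
Proof. by apply/setoid_classP; rewrite setoid_reprK. Qed.

Definition quot_add (R : pzRingType) (T : setoid_module R)
    (p q : setoid_quot T) : setoid_quot T :=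
  setoid_class (sm_add (setoid_repr p) (setoid_repr q)).

Definition quot_scale (R : pzRingType) (T : setoid_module R) (a : R)
    (q : setoid_quot T) : setoid_quot T :=
  setoid_class (sm_scale a (setoid_repr q)).

Lemma quot_addE (R : pzRingType) (T : setoid_module R) (t u : T) :
  quot_add (setoid_class t) (setoid_class u) = setoid_class (sm_add t u).
Proof. by apply/setoid_classP/sm_add_eq; apply: sm_eq_repr. Qed.

Lemma quot_scaleE (R : pzRingType) (T : setoid_module R) (a : R) (t : T) :
  quot_scale a (setoid_class t) = setoid_class (sm_scale a t).
Proof. by apply/setoid_classP/sm_scale_eq; apply: sm_eq_repr. Qed.

Lemma setoid_quot_ind (R : pzRingType) (T : setoid_module R)
    (P : setoid_quot T -> Prop) :
  (forall t, P (setoid_class t)) -> forall q, P q.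
Proof. by move=> h q; rewrite -(setoid_reprK q). Qed.

Lemma quot_addA (R : pzRingType) (T : setoid_module R) :
  associative (@quot_add R T).
Proof.
elim/setoid_quot_ind=> t; elim/setoid_quot_ind=> u; elim/setoid_quot_ind=> v.
by rewrite !quot_addE; apply/setoid_classP/sm_addA.
Qed.

Lemma quot_addC (R : pzRingType) (T : setoid_module R) :
  commutative (@quot_add R T).
Proof.
elim/setoid_quot_ind=> t; elim/setoid_quot_ind=> u.
by rewrite !quot_addE; apply/setoid_classP/sm_addC.
Qed.

Lemma quot_add0 (R : pzRingType) (T : setoid_module R) :
  left_id (setoid_class (sm_zero T)) (@quot_add R T).
Proof.
by elim/setoid_quot_ind=> t; rewrite quot_addE; apply/setoid_classP/sm_add0.
Qed.

Lemma quot_addN (R : pzRingType) (T : setoid_module R) :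
  left_inverse (setoid_class (sm_zero T)) (quot_scale (-1)) (@quot_add R T).
Proof.
elim/setoid_quot_ind=> t.
by rewrite quot_scaleE quot_addE; apply/setoid_classP/sm_addN.
Qed.

HB.instance Definition _ (R : pzRingType) (T : setoid_module R) :=
  GRing.isZmodule.Build (setoid_quot T)
    (@quot_addA R T) (@quot_addC R T) (@quot_add0 R T) (@quot_addN R T).

Lemma quot_scaleA (R : pzRingType) (T : setoid_module R) (a b : R)
  (q : setoid_quot T) : quot_scale a (quot_scale b q) = quot_scale (a * b) q.
Proof.
elim/setoid_quot_ind: q => t.
by rewrite !quot_scaleE; apply/setoid_classP/sm_scaleA.
Qed.

Lemma quot_scale1 (R : pzRingType) (T : setoid_module R) :
  left_id 1 (@quot_scale R T).
Proof.
by elim/setoid_quot_ind=> t; rewrite quot_scaleE; apply/setoid_classP/sm_scale1.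
Qed.

Lemma quot_scaleDr (R : pzRingType) (T : setoid_module R) :
  right_distributive (@quot_scale R T) +%R.
Proof.
move=> a; elim/setoid_quot_ind=> t; elim/setoid_quot_ind=> u.
have addE : +%R = @quot_add R T by [].
rewrite addE !(quot_addE, quot_scaleE).
exact/setoid_classP/sm_scaleDr.
Qed.

Lemma quot_scaleDl (R : pzRingType) (T : setoid_module R) (q : setoid_quot T) :
  {morph (@quot_scale R T)^~ q : a b / a + b}.
Proof.
elim/setoid_quot_ind: q => t a b; have addE : +%R = @quot_add R T by [].
rewrite [in RHS]addE !(quot_addE, quot_scaleE).
exact/setoid_classP/sm_scaleDl.
Qed.

HB.instance Definition _ (R : pzRingType) (T : setoid_module R) :=
  GRing.Zmodule_isLmodule.Build R (setoid_quot T)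
    (@quot_scaleA R T) (@quot_scale1 R T) (@quot_scaleDr R T)
    (@quot_scaleDl R T).

Lemma setoid_classD (R : pzRingType) (T : setoid_module R) (t u : T) :
  setoid_class (sm_add t u) = setoid_class t + setoid_class u.
Proof. by rewrite -quot_addE. Qed.

Lemma setoid_classZ (R : pzRingType) (T : setoid_module R) (a : R) (t : T) :
  setoid_class (sm_scale a t) = a *: setoid_class t.
Proof. by rewrite -quot_scaleE. Qed.

(** * Subquotients and factorizations *)

Definition submodule (R : pzRingType) (M : lmodType R) (Z : M -> Prop) : Prop :=
  Z 0 /\ forall a x y, Z x -> Z y -> Z (a *: x + y).

Lemma submoduleD (R : pzRingType) (M : lmodType R) (Z : M -> Prop) x y :
  submodule Z -> Z x -> Z y -> Z (x + y).
Proof. by move=> [_ ZP] Zx Zy; rewrite -[x]scale1r; apply: ZP. Qed.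

Lemma submoduleZ (R : pzRingType) (M : lmodType R) (Z : M -> Prop) a x :
  submodule Z -> Z x -> Z (a *: x).
Proof. by move=> [Z0 ZP] Zx; rewrite -[_ *: _]addr0; apply: ZP. Qed.

Lemma submodule_image (R : pzRingType) (M N : lmodType R)
    (f : {linear M -> N}) :
  submodule (fun y => exists x, f x = y).
Proof.
split; first by exists 0; rewrite linear0.
by move=> a _ _ [x <-] [y <-]; exists (a *: x + y); rewrite linearP.
Qed.

Lemma submodule_ker (R : pzRingType) (M N : lmodType R) (f : {linear M -> N}) :
  submodule (fun x => f x = 0).
Proof.
split; first exact: linear0.
by move=> a x y fx fy; rewrite linearP fx fy scaler0 addr0.
Qed.

Lemma lmod_quotient (R : pzRingType) (M : lmodType R) (Z : M -> Prop) :
  submodule Z -> exists (Q : lmodType R) (p : {linear M -> Q}),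
    surjective p /\ forall x, p x = 0 <-> Z x.
Proof.
move=> subZ; have [Z0 _] := subZ.
have ZN x y : Z (x - y) -> Z (y - x).
  by move=> h; rewrite -opprB -scaleN1r; apply: submoduleZ.
have Zeq x y : x = y -> Z (x - y) by move->; rewrite subrr.
have @T : setoid_module R.
  exists M (fun x y => Z (x - y)) 0 +%R *:%R => //.
  - by move=> x; apply: Zeq.
  - by move=> x y z xy yz; rewrite -(subrKA y); apply: submoduleD.
  - by move=> x x' y y' xx' yy'; rewrite opprD addrACA; apply: submoduleD.
  - by move=> a x x' xx'; rewrite -scalerBr; apply: submoduleZ.
  - by move=> x y z; apply: Zeq; rewrite addrA.
  - by move=> x y; apply: Zeq; rewrite addrC.
  - by move=> x; apply: Zeq; rewrite add0r.
  - by move=> x; apply: Zeq; rewrite scaleN1r addNr.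
  - by move=> a b x; apply: Zeq; rewrite scalerA.
  - by move=> x; apply: Zeq; rewrite scale1r.
  - by move=> a x y; apply: Zeq; rewrite scalerDr.
  - by move=> a b x; apply: Zeq; rewrite scalerDl.
have lin : linear (@setoid_class R T : M -> setoid_quot T).
  by move=> a x y; rewrite -setoid_classZ -setoid_classD.
exists (setoid_quot T), (linear_map lin); split.
  by elim/setoid_quot_ind=> t; exists t.
by move=> x; rewrite -[X in Z X]subr0; apply: (@setoid_classP R T x 0).
Qed.

Lemma lmod_sub (R : pzRingType) (M : lmodType R) (Z : M -> Prop) :
  submodule Z -> exists (K : lmodType R) (u : {linear K -> M}),
    injective u /\ forall y, Z y <-> exists x, u x = y.
Proof.
move=> subZ; have [Z0 _] := subZ.
have @T : setoid_module R.
  exists {x | Z x} (fun x y => sval x = sval y) (exist _ 0 Z0)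
    (fun x y => exist _ _ (submoduleD subZ (svalP x) (svalP y)))
    (fun a x => exist _ _ (submoduleZ a subZ (svalP x))) => //=.
  - by move=> x y z -> ->.
  - by move=> x x' y y' -> ->.
  - by move=> a x x' ->.
  - by move=> x y z; rewrite addrA.
  - by move=> x y; rewrite addrC.
  - by move=> x; rewrite add0r.
  - by move=> x; rewrite scaleN1r addNr.
  - by move=> a b x; rewrite scalerA.
  - by move=> x; rewrite scale1r.
  - by move=> a x y; rewrite scalerDr.
  - by move=> a b x; rewrite scalerDl.
pose u (q : setoid_quot T) : M := sval (setoid_repr q).
have uE t : u (setoid_class t) = sval t by apply: (@sm_eq_repr R T t).
have lin : linear u.
  move=> a; elim/setoid_quot_ind=> t; elim/setoid_quot_ind=> s.
  by rewrite -setoid_classZ -setoid_classD !uE.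
exists (setoid_quot T), (linear_map lin); split.
  move=> p q; rewrite !linear_mapE => pq.
  by rewrite -(setoid_reprK p) -(setoid_reprK q); apply/setoid_classP.
move=> y; split=> [Zy|[q <-]]; last exact: svalP.
by exists (@setoid_class R T (exist _ y Zy)); rewrite linear_mapE uE.
Qed.

(** Choose any section [f] of [G]. The defect of linearity of [f] is related to 0 by compatibility
    of [G] with the operations, hence vanishes. Factorizations and maps out of direct limits are
    obtained this way. *)
Lemma linear_of_graph (R : pzRingType) (M N : lmodType R) (G : M -> N -> Prop) :
    (forall x, exists y, G x y) ->
    (forall a x x' y y', G x y -> G x' y' -> G (a *: x + x') (a *: y + y')) ->
    (forall y, G 0 y -> y = 0) ->
  exists f : {linear M -> N}, forall x, G x (f x).
Proof.
move=> /choice[f fP] Glin G0.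
have lin : linear f.
  move=> a x y.
  have := Glin (-1) _ _ _ _ (fP (a *: x + y)) (Glin a _ _ _ _ (fP x) (fP y)).
  by rewrite !scaleN1r addNr => /G0/eqP; rewrite addr_eq0 eqr_opp => /eqP.
by exists (linear_map lin).
Qed.

Lemma factor_surj (R : pzRingType) (M Q N : lmodType R) (p : {linear M -> Q})
    (f : {linear M -> N}) :
    surjective p -> (forall x, p x = 0 -> f x = 0) ->
  exists g : {linear Q -> N}, forall x, g (p x) = f x.
Proof.
move=> p_surj kerf.
have [q|a _ _ _ _ [x [<- <-]] [y [<- <-]]|_ [x [px <-]]|g gP] :=
  @linear_of_graph R Q N (fun q y => exists x, p x = q /\ f x = y).
- by have [x <-] := p_surj q; exists (f x), x.
- by exists (a *: x + y); rewrite !linearP.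
- exact: kerf.
exists g => x; have [y [pxy <-]] := gP (p x).
by apply/eqP; rewrite -subr_eq0 -linearB kerf // linearB pxy subrr.
Qed.

Lemma factor_inj (R : pzRingType) (K M N : lmodType R) (u : {linear K -> M})
    (f : {linear N -> M}) :
    injective u -> (forall y, exists x, u x = f y) ->
  exists g : {linear N -> K}, forall y, u (g y) = f y.
Proof.
move=> u_inj imf.
apply: (@linear_of_graph R N K (fun y x => u x = f y)) => //.
  by move=> a y y' x x' uy uy'; rewrite !linearP uy uy'.
by move=> x ux; apply: u_inj; rewrite ux !linear0.
Qed.

Lemma linear_inverse (R : pzRingType) (M N : lmodType R) (f : {linear M -> N}) :
    bijective f ->
  exists g : {linear N -> M}, cancel f g /\ cancel g f.
Proof.
move=> f_bij; have f_inj := bij_inj f_bij; have [h fK hK] := f_bij.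
have [y|g gP] := factor_inj (f := idfun) f_inj; first by exists (h y).
by exists g; split=> // x; apply: f_inj; rewrite gP.
Qed.

Lemma lmod_iso_sym (R : pzRingType) (M N : lmodType R) :
  lmod_iso M N -> lmod_iso N M.
Proof.
by move=> [f /linear_inverse[g [fK gK]]]; exists g; exists f.
Qed.

(** Projectivity speaks of surjections only, so [p] and [f] are first corestricted to the image of
    [p]. *)
Lemma projective_lift (R : pzRingType) (P A B : lmodType R)
    (p : {linear A -> B}) (f : {linear P -> B}) :
    projective_module P -> (forall x, exists y, p y = f x) ->
  exists g : {linear P -> A}, forall x, p (g x) = f x.
Proof.
move=> projP imf; have [K [u [u_inj uP]]] := lmod_sub (submodule_image p).
have [y|p' p'P] := factor_inj (f := p) u_inj; first by apply/uP; exists y.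
have [x|f' f'P] := factor_inj (f := f) u_inj; first exact/uP.
have [k|g gP] := projP _ _ p' f'.
  have [a pa] : exists x, p x = u k by apply/uP; exists k.
  by exists a; apply: u_inj; rewrite p'P.
by exists g => x; rewrite -p'P gP f'P.
Qed.

(** Dual to [projective_lift]: since [f] kills the kernel of [u], it descends to the image of [u],
    and from there injectivity extends it to [B]. *)
Lemma injective_extend (R : pzRingType) (E A B : lmodType R)
    (u : {linear A -> B}) (f : {linear A -> E}) :
    injective_module E -> (forall x, u x = 0 -> f x = 0) ->
  exists g : {linear B -> E}, forall x, g (u x) = f x.
Proof.
move=> injE kerf; have [K [v [v_inj vP]]] := lmod_sub (submodule_image u).
have [x|u' u'P] := factor_inj (f := u) v_inj; first by apply/vP; exists x.
have [k|x u'x|f' f'P] := @factor_surj _ _ _ _ u' f.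
- have [a ua] : exists x, u x = v k by apply/vP; exists k.
  by exists a; apply: v_inj; rewrite u'P.
- by apply: kerf; rewrite -u'P u'x linear0.
have [g gP] := injE _ _ v f' v_inj.
by exists g => x; rewrite -u'P gP f'P.
Qed.

(** * Free modules *)

Inductive free_term (R T : Type) :=
| free_zero
| free_var of T
| free_add of free_term R T & free_term R T
| free_scale of R & free_term R T.
Arguments free_zero {R T}.
Arguments free_var {R T}.

Fixpoint free_eval (R : pzRingType) (T : Type) (N : lmodType R) (phi : T -> N)
    (t : free_term R T) : N :=
  match t with
  | free_zero => 0
  | free_var x => phi x
  | free_add t u => free_eval phi t + free_eval phi u
  | free_scale a t => a *: free_eval phi t
  end.

(* Two terms are identified when they agree under every evaluation in a module,
   so that the module axioms and the universal property come for free. *)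
Definition free_setoid (R : pzRingType) (T : Type) : setoid_module R.
Proof.
exists (free_term R T)
  (fun t u => forall (N : lmodType R) (phi : T -> N),
    free_eval phi t = free_eval phi u)
  free_zero (@free_add R T) (@free_scale R T) => //=.
- by move=> x y z xy yz N phi; rewrite xy yz.
- by move=> x x' y y' xx' yy' N phi; rewrite xx' yy'.
- by move=> a x x' xx' N phi; rewrite xx'.
- by move=> x y z N phi; rewrite addrA.
- by move=> x y N phi; rewrite addrC.
- by move=> x N phi; rewrite add0r.
- by move=> x N phi; rewrite scaleN1r addNr.
- by move=> a b x N phi; rewrite scalerA.
- by move=> x N phi; rewrite scale1r.
- by move=> a x y N phi; rewrite scalerDr.
- by move=> a b x N phi; rewrite scalerDl.
Defined.

Definition free_module (R : pzRingType) (T : Type) : lmodType R :=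
  setoid_quot (free_setoid R T).

Definition free_gen (R : pzRingType) (T : Type) (t : T) : free_module R T :=
  @setoid_class R (free_setoid R T) (free_var t).

Lemma free_extend (R : pzRingType) (T : Type) (N : lmodType R) (phi : T -> N) :
  exists g : {linear free_module R T -> N}, forall t, g (free_gen R t) = phi t.
Proof.
pose g (q : free_module R T) : N := free_eval phi (setoid_repr q).
have gE t : g (@setoid_class R (free_setoid R T) t) = free_eval phi t.
  exact: (@sm_eq_repr R (free_setoid R T) t).
have lin : linear g.
  move=> a; elim/setoid_quot_ind=> t; elim/setoid_quot_ind=> u.
  by rewrite -setoid_classZ -setoid_classD !gE.
by exists (linear_map lin) => t; rewrite linear_mapE gE.
Qed.

Lemma free_ind (R : pzRingType) (T : Type) (Z : free_module R T -> Prop) :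
  submodule Z -> (forall t, Z (free_gen R t)) -> forall q, Z q.
Proof.
move=> subZ Zgen; elim/setoid_quot_ind; elim=> [|t|t Zt u Zu|a t Zt].
- exact: subZ.1.
- exact: Zgen.
- by rewrite (setoid_classD (t : free_setoid R T)); apply: submoduleD.
- by rewrite (setoid_classZ a (t : free_setoid R T)); apply: submoduleZ.
Qed.

Lemma free_projective (R : pzRingType) (T : Type) :
  projective_module (free_module R T).
Proof.
move=> A B p f p_surj.
have [phi phiP] := choice (fun t => p_surj (f (free_gen R t))).
have [g gP] := free_extend phi; exists g; apply: free_ind => [|t].
  split=> [|a x y pgx pgy]; first by rewrite !linear0.
  by rewrite !linearP pgx pgy.
by rewrite gP phiP.
Qed.

Lemma projective_cover (R : pzRingType) (M : lmodType R) (Z : M -> Prop) :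
  submodule Z -> exists (P : lmodType R) (p : {linear P -> M}),
    projective_module P /\ forall y, Z y <-> exists x, p x = y.
Proof.
move=> subZ; have [p pP] := free_extend (fun t : {x | Z x} => sval t).
exists (free_module R {x | Z x}), p; split; first exact: free_projective.
move=> y; split=> [Zy|[x <-]].
  by exists (free_gen R (exist _ y Zy)); rewrite pP.
move: x; apply: free_ind => [|t]; last by rewrite pP; apply: svalP.
split=> [|a x x' Zx Zx']; first by rewrite linear0; apply: subZ.1.
by rewrite linearP; apply: subZ.2.
Qed.

(** * Direct limits *)

Lemma directed_bound (d : Order.disp_t) (J : porderType d) (k : nat)
    (j : 'I_k -> J) :
  directed J -> exists l, forall i, (j i <= l)%O.
Proof.
move=> [[j0] ub]; elim: k j => [|k IHk] j; first by exists j0 => -[].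
have [l lP] := IHk (fun i => j (lift ord0 i)).
have [m [lm jm]] := ub l (j ord0); exists m => i.
by have [i'->|->//] := unliftP ord0 i; apply: le_trans (lP i') lm.
Qed.

(** The elementwise description of a direct limit; for directed [J] it is equivalent to the
    universal property, and it is what the computations use. *)
Definition dirlim_model (R : pzRingType) (d : Order.disp_t) (J : porderType d)
    (S : direct_system R J) (X : lmodType R)
    (c : forall j, {linear S j -> X}) : Prop :=
  [/\ is_cocone c, forall x, exists j y, c j y = x
    & forall j (y : S j), c j y = 0 ->
        exists k (le_jk : (j <= k)%O), ds_map S le_jk y = 0].

(** The elements are families over all of [J] that follow the transition maps from some index on,
    modulo eventual equality. Compared with a quotient of the disjoint union, this keeps the
    operations pointwise. *)
Lemma dirlim_model_exists (R : pzRingType) (d : Order.disp_t)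
    (J : porderType d) (S : direct_system R J) :
    directed J ->
  exists (X : lmodType R) (c : forall j, {linear S j -> X}), dirlim_model c.
Proof.
move=> [[j0] ub].
pose coherent (s : forall j, S j) (i : J) := forall j (le_ij : (i <= j)%O),
  s j = ds_map S le_ij (s i).
have coherent_le s i k : coherent s i -> (i <= k)%O -> coherent s k.
  move=> si ik j kj; rewrite (si _ ik) (si _ (le_trans ik kj)).
  by rewrite (ds_map_comp ik kj (le_trans ik kj)).
pose car := {s : forall j, S j | exists i, coherent s i}.
pose mk s (s_coh : exists i, coherent s i) : car := exist _ s s_coh.
pose ev_eq (s t : car) := exists i, forall j, (i <= j)%O -> sval s j = sval t j.
have coh0 : exists i, coherent (fun j => 0) i.
  by exists j0 => j j0j; rewrite linear0.
have cohD (s t : car) : exists i, coherent (fun j => sval s j + sval t j) i.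
  have [i si] := svalP s; have [k tk] := svalP t; have [l [il kl]] := ub i k.
  exists l => j lj; rewrite linearD.
  by rewrite -(coherent_le _ _ _ si il) -(coherent_le _ _ _ tk kl).
have cohZ (a : R) (s : car) : exists i, coherent (fun j => a *: sval s j) i.
  by have [i si] := svalP s; exists i => j ij; rewrite linearZ /= -si.
have ev_eqT s t : (forall j, sval s j = sval t j) -> ev_eq s t.
  by move=> st; exists j0.
have @T : setoid_module R.
  exists car ev_eq (mk _ coh0) (fun s t => mk _ (cohD s t))
    (fun a s => mk _ (cohZ a s)).
  - by move=> s; apply: ev_eqT.
  - by move=> s t [i st]; exists i => j ij; rewrite st.
  - move=> s t r [i st] [k tr]; have [l [il kl]] := ub i k; exists l => j lj.
    by rewrite st ?tr // ?(le_trans il) // (le_trans kl).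
  - move=> s s' t t' [i ss'] [k tt']; have [l [il kl]] := ub i k.
    exists l => j lj /=.
    by rewrite ss' ?tt' // ?(le_trans il) // (le_trans kl).
  - by move=> a s s' [i ss']; exists i => j ij /=; rewrite ss'.
  - by move=> s t r; apply: ev_eqT => j /=; rewrite addrA.
  - by move=> s t; apply: ev_eqT => j /=; rewrite addrC.
  - by move=> s; apply: ev_eqT => j /=; rewrite add0r.
  - by move=> s; apply: ev_eqT => j /=; rewrite scaleN1r addNr.
  - by move=> a b s; apply: ev_eqT => j /=; rewrite scalerA.
  - by move=> s; apply: ev_eqT => j /=; rewrite scale1r.
  - by move=> a s t; apply: ev_eqT => j /=; rewrite scalerDr.
  - by move=> a b s; apply: ev_eqT => j /=; rewrite scalerDl.
(* The family representing [x]: its images above [j], and the filler 0 elsewhere, which eventual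
   equality ignores. *)
pose sec j (x : S j) k : S k :=
  if pselect (j <= k)%O is left le_jk then ds_map S le_jk x else 0.
have secE j (x : S j) k (le_jk : (j <= k)%O) : sec j x k = ds_map S le_jk x.
  rewrite /sec; case: pselect => // le_jk'.
  by rewrite (Prop_irrelevance le_jk' le_jk).
have coh_sec j (x : S j) : exists i, coherent (sec j x) i.
  exists j => k jk; rewrite (secE _ _ _ (lexx j)) (secE _ _ _ jk).
  by rewrite (ds_map_comp (lexx j) jk jk).
pose c j (x : S j) : setoid_quot T := @setoid_class R T (mk _ (coh_sec j x)).
have c_lin j : linear (c j).
  move=> a x y; rewrite /c -setoid_classZ -setoid_classD.
  apply/setoid_classP; exists j => k jk /=.
  by rewrite !(secE _ _ _ jk) linearP.
exists (setoid_quot T), (fun j => linear_map (c_lin j)); split.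
- move=> i j ij x; rewrite !linear_mapE.
  apply/setoid_classP; exists j => k jk /=.
  rewrite (secE _ _ _ jk) (secE _ _ _ (le_trans ij jk)).
  by rewrite (ds_map_comp _ _ (le_trans ij jk)).
- elim/setoid_quot_ind=> s; have [i si] := svalP s; exists i, (sval s i).
  rewrite linear_mapE; apply/setoid_classP; exists i => k ik /=.
  by rewrite (secE _ _ _ ik) -si.
- move=> j y; rewrite linear_mapE => /setoid_classP[i h].
  have [k [ik jk]] := ub i j; exists k, jk.
  by have := h k ik; rewrite /= (secE _ _ _ jk).
Qed.

Lemma dirlim_model_univ (R : pzRingType) (d : Order.disp_t) (J : porderType d)
    (S : direct_system R J) (X : lmodType R) (c : forall j, {linear S j -> X})
    (Y : lmodType R) (c' : forall j, {linear S j -> Y}) :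
    directed J -> dirlim_model c -> is_cocone c' ->
  exists h : {linear X -> Y},
    (forall j (x : S j), h (c j x) = c' j x) /\
    forall h' : {linear X -> Y},
      (forall j (x : S j), h' (c j x) = c' j x) -> h' =1 h.
Proof.
move=> [_ ub] [c_co c_surj c_inj] c'_co.
have [x|a _ _ _ _ [i [x [<- <-]]] [j [y [<- <-]]]|_ [i [x [cx <-]]]|h hP] :=
  @linear_of_graph R X Y (fun x y => exists i z, c i z = x /\ c' i z = y).
- by have [i [z <-]] := c_surj x; exists (c' i z), i, z.
- have [k [ik jk]] := ub i j.
  exists k, (a *: ds_map S ik x + ds_map S jk y).
  by rewrite !linearP !c_co !c'_co.
- have [k [ik xk]] := c_inj _ _ cx.
  by rewrite -(c'_co _ _ ik) xk linear0.
exists h; split=> [i x|h' h'P x].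
  (* The graph may represent [c i x] by [z] at another index [j]; the images of [x] and [z] at [k]
     have a difference that dies at some [l], where [c'] can compare them. *)
  have [j [z [cz <-]]] := hP (c i x); have [k [ik jk]] := ub i j.
  have [|l [kl]] := c_inj k (ds_map S jk z - ds_map S ik x).
    by rewrite linearB !c_co cz subrr.
  rewrite linearB => /eqP; rewrite subr_eq0 => /eqP zx.
  by rewrite -(c'_co _ _ jk) -(c'_co _ _ kl) zx !c'_co.
by have [i [z [<- <-]]] := hP x; apply: h'P.
Qed.

Lemma dirlim_model_limit (R : pzRingType) (d : Order.disp_t) (J : porderType d)
    (S : direct_system R J) (X : lmodType R) (c : forall j, {linear S j -> X}) :
  directed J -> dirlim_model c -> is_direct_limit S X.
Proof.
move=> dirJ c_mod; exists c; split; first by case: c_mod.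
by move=> Y c'; apply: dirlim_model_univ.
Qed.

(** Compare [X] with a constructed model [X']. The comparison [h] has the left inverse [h'], by
    uniqueness of the endomorphism of [X] compatible with [c]; both elementwise properties are then
    pulled back along [h]. *)
Lemma direct_limitP (R : pzRingType) (d : Order.disp_t) (J : porderType d)
    (S : direct_system R J) (X : lmodType R) :
    directed J -> is_direct_limit S X ->
  exists c : forall j, {linear S j -> X}, dirlim_model c.
Proof.
move=> dirJ [c [c_co c_univ]]; exists c.
have [X' [c' c'P]] := dirlim_model_exists S dirJ.
have [c'_co c'_surj c'_inj] := c'P.
have [h [hc _]] := c_univ _ _ c'_co.
have [h' [h'c' _]] := dirlim_model_univ dirJ c'P c_co.
have [e [_ e_uniq]] := c_univ _ _ c_co.
have h'hK x : h' (h x) = x.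
  have idE : (idfun : {linear X -> X}) =1 e by apply: e_uniq.
  have hE : (h' \o h : {linear X -> X}) =1 e.
    by apply: e_uniq => j y; rewrite /= hc h'c'.
  by have := hE x; rewrite -idE.
split=> // [x|j y cy]; last by apply: c'_inj; rewrite -hc cy linear0.
have [j [y hx]] := c'_surj (h x); exists j, y.
by rewrite -h'c' hx h'hK.
Qed.

(** * Finitely generated free modules and finite presentation *)

Lemma rV_extend (R : pzRingType) (k : nat) (N : lmodType R) (x : 'I_k -> N) :
  exists g : {linear 'rV[R]_k -> N}, forall i, g (delta_mx 0 i) = x i.
Proof.
have lin : linear (fun w : 'rV[R]_k => \sum_i w 0 i *: x i).
  move=> a v w; rewrite scaler_sumr -big_split /=; apply: eq_bigr => i _.
  by rewrite !mxE scalerDl scalerA.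
exists (linear_map lin) => i; rewrite linear_mapE (bigD1 i) //= big1 ?addr0.
  by rewrite mxE !eqxx scale1r.
by move=> j /negbTE ji; rewrite mxE ji andbF scale0r.
Qed.

Lemma fg_free_basis (R : pzRingType) (F : lmodType R) :
    fg_free F ->
  exists (k : nat) (b : 'I_k -> F),
    (forall (N : lmodType R) (x : 'I_k -> N),
       exists g : {linear F -> N}, forall i, g (b i) = x i) /\
    (forall (N : lmodType R) (f g : {linear F -> N}),
       (forall i, f (b i) = g (b i)) -> f =1 g).
Proof.
move=> [k [f /linear_inverse[g [fK gK]]]].
exists k, (fun i => g (delta_mx 0 i)); split=> [N x|N h h' hh' x].
  have [e eP] := rV_extend x; exists (e \o f) => i.
  by rewrite /= gK eP.
rewrite -(fK x) (row_sum_delta (f x)) !linear_sum; apply: eq_bigr => i _.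
by rewrite !linearZ /= hh'.
Qed.

Lemma fg_free_projective (R : pzRingType) (F : lmodType R) :
  fg_free F -> projective_module F.
Proof.
move=> /fg_free_basis[k [b [ext uniq]]] A B p f p_surj.
have [x xP] := choice (fun i => p_surj (f (b i))).
have [g gP] := ext _ x; exists g; apply: (uniq _ (p \o g)) => i.
by rewrite /= gP xP.
Qed.

(** Each of the finitely many basis images comes from some stage, and directedness provides a common
    one. *)
Lemma fg_free_dirlim_lift (R : pzRingType) (d : Order.disp_t)
    (J : porderType d) (S : direct_system R J) (X : lmodType R)
    (c : forall j, {linear S j -> X}) (F : lmodType R) (f : {linear F -> X}) :
    directed J -> dirlim_model c -> fg_free F ->
  exists j (g : {linear F -> S j}), forall x, c j (g x) = f x.
Proof.
move=> dirJ [c_co c_surj _] /fg_free_basis[k [b [ext uniq]]].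
have /choice[j jP] i : exists j, exists y, c j y = f (b i) by apply: c_surj.
have [l jl] := directed_bound j dirJ.
have /choice[y yP] i : exists y, c l y = f (b i).
  by have [z <-] := jP i; exists (ds_map S (jl i) z); rewrite c_co.
have [g gP] := ext _ y; exists l, g; apply: (uniq _ (c l \o g)) => i.
by rewrite /= gP yP.
Qed.

Lemma fg_free_dirlim_ker (R : pzRingType) (d : Order.disp_t)
    (J : porderType d) (S : direct_system R J) (X : lmodType R)
    (c : forall j, {linear S j -> X}) (F : lmodType R) (j : J)
    (f : {linear F -> S j}) :
    directed J -> dirlim_model c -> fg_free F -> (forall x, c j (f x) = 0) ->
  exists k (le_jk : (j <= k)%O), forall x, ds_map S le_jk (f x) = 0.
Proof.
move=> dirJ [_ _ c_inj] /fg_free_basis[k [b [_ uniq]]] cf.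
have /choice[l lP] i := c_inj _ _ (cf (b i)).
have [m lm] := directed_bound l dirJ.
have [n [mn jn]] := dirJ.2 m j.
exists n, jn; apply: (uniq _ (ds_map S jn \o f) \0) => i /=.
have [jl bl] := lP i.
by rewrite -(ds_map_comp jl (le_trans (lm i) mn) jn) bl linear0.
Qed.

Lemma FP0P (R : pzRingType) (M : lmodType R) :
  FP 0 M <-> exists (F : lmodType R) (e : {linear F -> M}),
    fg_free F /\ surjective e.
Proof.
split=> [[F [d [e [F_fg e_surj _ _]]]]|[F [e [F_fg e_surj]]]].
  by exists (F 0%N), e; split=> //; apply: F_fg.
(* For [n = 0] both exactness conditions are vacuous; the terms above degree 0 are filler. *)
by exists (fun=> F), (fun=> \0), e; split.
Qed.

Definition cons_obj (R : pzRingType) (F0 : lmodType R) (F : nat -> lmodType R)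
    (i : nat) : lmodType R :=
  if i is j.+1 then F j else F0.

Definition cons_d (R : pzRingType) (F0 K : lmodType R) (u : {linear K -> F0})
    (F : nat -> lmodType R) (d : forall i, {linear F i.+1 -> F i})
    (e : {linear F 0%N -> K}) (i : nat) :
    {linear cons_obj F0 F i.+1 -> cons_obj F0 F i} :=
  match i with 0 => u \o e | j.+1 => d j end.

Lemma exact_at_comp (R : pzRingType) (A K B C : lmodType R)
    (e : {linear A -> K}) (u : {linear K -> B}) (f : {linear B -> C}) :
  surjective e -> exact_at u f -> exact_at (u \o e) f.
Proof.
move=> e_surj uf y; split=> [/uf[k <-]|[x <-]]; last by apply/uf; exists (e x).
by have [x <-] := e_surj k; exists x.
Qed.

Lemma exact_at_inj_comp (R : pzRingType) (A B K C : lmodType R)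
    (f : {linear A -> B}) (e : {linear B -> K}) (u : {linear K -> C}) :
  injective u -> exact_at f (u \o e) <-> exact_at f e.
Proof.
move=> u_inj; have ue y : u (e y) = 0 <-> e y = 0.
  by split=> [uey|->]; [apply: u_inj; rewrite uey linear0 | rewrite linear0].
by split=> fe y; rewrite -fe; [apply: iff_sym|]; apply: ue.
Qed.

(** Cutting the presentation at the kernel of [e], and splicing it back, lets later inductions on
    [n] pass from a module to its first syzygy. *)
Lemma FP_S (R : pzRingType) (n : nat) (M : lmodType R) :
  FP n.+1 M <-> exists (F K : lmodType R) (u : {linear K -> F})
      (e : {linear F -> M}),
    [/\ fg_free F, FP n K, injective u, surjective e & exact_at u e].
Proof.
split=> [[F [d [e [F_fg e_surj de dd]]]]|].
  have [K [u [u_inj uP]]] := lmod_sub (submodule_ker e).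
  have [y|e' e'P] := factor_inj (f := d 0%N) u_inj.
    by apply/uP/de => //; exists y.
  exists (F 0%N), K, u, e; split=> //; first exact: F_fg.
  exists (fun i => F i.+1), (fun i => d i.+1), e'; split.
  - by move=> i ltin; apply: F_fg.
  - move=> k; have [|x dx] := (de isT (u k)).1; first by apply/uP; exists k.
    by exists x; apply: u_inj; rewrite e'P.
  - move=> n_gt0; apply/(exact_at_inj_comp _ _ u_inj) => y.
    by rewrite /= e'P; apply: dd.
  - by move=> i ltin; apply: dd.
move=> [F0 [K [u [e [F0_fg FPK u_inj e_surj ue]]]]].
have [F [d [e' [F_fg e'_surj de dd]]]] := FPK.
exists (cons_obj F0 F), (cons_d u d e'), e; split=> //.
- by case=> //= i ltin; apply: F_fg.
- by move=> _; apply: exact_at_comp.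
- case=> [|i] ltin; last exact: dd.
  by apply/exact_at_inj_comp => //; apply: de.
Qed.

(** * Resolutions *)

(** [Ext_zero] read in one fixed resolution; dimension shifting takes place there. *)
Definition cohomology_zero (R : pzRingType) (M : lmodType R)
    (P : projective_resolution M) (n : nat) (X : lmodType R) : Prop :=
  forall f : {linear P n -> X}, is_cocycle f -> is_coboundary f.

(** Bundling the endpoints with the map lets a resolution be built by plain iteration, without
    dependent recursion. *)
Record arrow (R : pzRingType) := Arrow {
  arrow_dom : lmodType R;
  arrow_cod : lmodType R;
  arrow_map :> {linear arrow_dom -> arrow_cod} }.

Lemma projective_resolution_exists (R : pzRingType) (M : lmodType R) :
  inhabited (projective_resolution M).
Proof.
have cover_ex (a : arrow R) := projective_cover (submodule_ker a).
pose cover a : arrow R := Arrow (sval (cid (svalP (cid (cover_ex a))))).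
have coverP a : projective_module (arrow_dom (cover a)) /\
    exact_at (cover a) a.
  exact: (svalP (cid (svalP (cid (cover_ex a))))).
(* The zero map on [M] has kernel [M], so its cover [st 1] is the augmentation. *)
pose st i := iter i cover (Arrow (\0 : {linear M -> M})).
constructor; exists (fun i => arrow_dom (st i.+1)) (fun i => st i.+2) (st 1%N).
- by move=> i; apply: (coverP _).1.
- by move=> y; apply/(coverP (st 0%N)).2.
- exact: (coverP (st 1%N)).2.
- by move=> i; apply: (coverP (st i.+2)).2.
Qed.

(** * Injective cogenerators and injective coresolutions *)

Lemma lmod_iso_injective (R : pzRingType) (M N : lmodType R) :
  lmod_iso M N -> injective_module N -> injective_module M.
Proof.
move=> [f /linear_inverse[g [fK gK]]] injN A B u h u_inj.
have [k kP] := injN _ _ u (f \o h) u_inj.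
by exists (g \o k) => x; rewrite /= kP /= fK.
Qed.

Lemma power_injective (R : pzRingType) (I : lmodType R) (T : Type) :
  injective_module I -> injective_module (T -> I : lmodType R).
Proof.
move=> injI A B u f u_inj.
have f_lin t : linear (fun a => f a t) by move=> a x y; rewrite linearP.
have /choice[g gP] t := injI _ _ u (linear_map (f_lin t)) u_inj.
have g_lin : linear (fun b t => g t b : I).
  by move=> a x y; apply/funext => t; rewrite linearP.
by exists (linear_map g_lin) => x; apply/funext => t; rewrite linear_mapE gP.
Qed.

(** If [y] were nonzero, the map from [R] sending [r] to [r *: y] would differ from the zero map,
    and some [h] would tell them apart. *)
Lemma cogenerator_separates (R : pzRingType) (I N : lmodType R) (y : N) :
  cogenerator I -> (forall h : {linear N -> I}, h y = 0) -> y = 0.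
Proof.
move=> cogI hy; apply/not_notP => y0.
have lin : linear (fun r : R^o => (r : R) *: y).
  by move=> a r s; rewrite scalerDl scalerA.
have [|h] := cogI R^o N (linear_map lin) \0.
  by move=> /(_ 1); rewrite linear_mapE scale1r.
by apply=> r /=; rewrite linearZ /= hy scaler0 linear0.
Qed.

(** Evaluation into the power of [I] indexed by the maps that kill [Z]; its kernel is exactly [Z]
    because maps into [I] separate the points of the quotient by [Z]. *)
Lemma injective_cocover (R : pzRingType) (I M : lmodType R) (Z : M -> Prop) :
    injective_module I -> cogenerator I -> submodule Z ->
  exists (E : lmodType R) (f : {linear M -> E}),
    injective_module E /\ forall x, f x = 0 <-> Z x.
Proof.
move=> injI cogI subZ; 
pose T := {h : {linear M -> I} | forall x, Z x -> h x = 0}.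
have lin : linear (fun x (t : T) => sval t x : I).
  by move=> a x y; apply/funext => t; rewrite linearP.
exists (T -> I), (linear_map lin); split; first exact: power_injective.
move=> x; split=> [fx|Zx]; last by apply/funext => t; apply: (svalP t).
have [Q [p [_ pP]]] := lmod_quotient subZ.
apply/pP/(cogenerator_separates cogI) => h.
have hp z : Z z -> (h \o p) z = 0 by move=> /pP /= ->; apply: linear0.
by have := congr1 (@^~ (exist _ (h \o p : {linear M -> I}) hp)) fx.
Qed.

Lemma injective_coresolution_exists (R : pzRingType) (I X : lmodType R) :
  injective_module I -> cogenerator I -> inhabited (injective_coresolution X).
Proof.
move=> injI cogI.
have cocover_ex (a : arrow R) :=
  injective_cocover injI cogI (submodule_image a).
pose cocover a : arrow R := Arrow (sval (cid (svalP (cid (cocover_ex a))))).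
have cocoverP a : injective_module (arrow_cod (cocover a)) /\
    exact_at a (cocover a).
  exact: (svalP (cid (svalP (cid (cocover_ex a))))).
(* The zero map on [X] has image 0, so [st 1] is injective. *)
pose st i := iter i cocover (Arrow (\0 : {linear X -> X})).
constructor; exists (fun i => arrow_cod (st i.+1)) (fun i => st i.+2) (st 1%N).
- by move=> i; apply: (cocoverP _).1.
- move=> x y xy; apply/eqP; rewrite -subr_eq0; apply/eqP.
  have [|z <-//] := ((cocoverP (st 0%N)).2 (x - y)).1.
  by rewrite linearB; apply/eqP; rewrite subr_eq0; apply/eqP.
- exact: (cocoverP (st 1%N)).2.
- by move=> i; apply: (cocoverP (st i.+2)).2.
Qed.

(** * Syzygies and dimension shifting *)

Definition cons_resolution (R : pzRingType) (M F K : lmodType R)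
    (u : {linear K -> F}) (e : {linear F -> M}) (projF : projective_module F)
    (u_inj : injective u) (e_surj : surjective e) (ue : exact_at u e)
    (P : projective_resolution K) : projective_resolution M.
Proof.
exists (cons_obj F P) (cons_d u (pr_d P) (pr_aug P)) e => //.
- by case=> [|i] //=; apply: pr_proj.
- by apply: exact_at_comp => //; apply: pr_aug_surj.
- case=> [|i]; last exact: pr_exact.
  by apply/exact_at_inj_comp => //; apply: pr_exact0.
Defined.

Lemma pr_d_aug (R : pzRingType) (M : lmodType R)
    (P : projective_resolution M) x :
  pr_aug P (pr_d P 0 x) = 0.
Proof. by apply/pr_exact0; exists x. Qed.

Lemma pr_d_d (R : pzRingType) (M : lmodType R)
    (P : projective_resolution M) i x :
  pr_d P i (pr_d P i.+1 x) = 0.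
Proof. by apply/pr_exact; exists x. Qed.

(** Prepending [F] to a resolution of [K] resolves [M] and raises degrees by one; in positive degree
    the two vanishing conditions then coincide by computation. *)
Lemma Ext_zero_syzygy (R : pzRingType) (n : nat) (M F K X : lmodType R)
    (u : {linear K -> F}) (e : {linear F -> M}) :
    projective_module F -> injective u -> surjective e -> exact_at u e ->
  Ext_zero n.+2 M X -> Ext_zero n.+1 K X.
Proof.
move=> projF u_inj e_surj ue extM P.
exact: (extM (cons_resolution projF u_inj e_surj ue P)).
Qed.

(** Composed with the augmentation of a resolution of [K], [f] becomes a 1-cocycle for [M]; a
    cochain bounding it is the extension. *)
Lemma Ext1_zero_extend (R : pzRingType) (M F K X : lmodType R)
    (u : {linear K -> F}) (e : {linear F -> M}) (f : {linear K -> X}) :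
    projective_module F -> injective u -> surjective e -> exact_at u e ->
    Ext_zero 1 M X ->
  exists g : {linear F -> X}, forall x, g (u x) = f x.
Proof.
move=> projF u_inj e_surj ue extM.
have [P] := projective_resolution_exists K.
have [x|g gP] := extM (cons_resolution projF u_inj e_surj ue P) (f \o pr_aug P).
  by rewrite /= pr_d_aug linear0.
exists g => k; have [x <-] := pr_aug_surj P k.
by rewrite [RHS]gP.
Qed.

(** The two directions are diagram chases for the connecting isomorphism: projectivity of the terms
    of [P] lifts along [p], and injectivity of [E] extends along the differentials. *)
Lemma cohomology_zero_shift (R : pzRingType) (M X E C : lmodType R)
    (P : projective_resolution M) (n : nat)
    (i : {linear X -> E}) (p : {linear E -> C}) :
    injective_module E -> injective i -> surjective p -> exact_at i p ->
  cohomology_zero P n.+2 X <-> cohomology_zero P n.+1 C.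
Proof.
move=> injE i_inj p_surj ip; have pi x : p (i x) = 0 by apply/ip; exists x.
split=> h f fd.
  have [f' f'P] := @pr_proj _ _ _ _ _ _ p f p_surj.
  have [x|f'' f''P] := @factor_inj _ _ _ _ i (f' \o pr_d P n.+1) i_inj.
    by apply/ip; rewrite /= f'P fd.
  have [x|g gP] := h f''.
    by apply: i_inj; rewrite f''P /= pr_d_d !linear0.
  (* The lift [f'] need not kill boundaries; subtracting [i \o g] corrects this, and [p] does not
     see the correction. *)
  have [x /pr_exact[y <-]|k kP] :=
      @injective_extend _ _ _ _ (pr_d P n) (f' \- (i \o g)) injE.
    by rewrite /= -gP f''P subrr.
  by exists (p \o k) => x; rewrite /= kP /= linearB pi subr0 f'P.
have [x /pr_exact[y <-]|f' f'P] :=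
    @injective_extend _ _ _ _ (pr_d P n.+1) (i \o f) injE.
  by rewrite /= fd linear0.
have [x|g gP] := h (p \o f').
  by rewrite /= f'P /= pi.
have [g' g'P] := @pr_proj _ _ _ _ _ _ p g p_surj.
(* The corrected [f'] is killed by [p], so it takes values in [X]; the correction disappears after
   composing with the next differential. *)
have [x|k kP] := @factor_inj _ _ _ _ i (f' \- (g' \o pr_d P n)) i_inj.
  by apply/ip; rewrite /= linearB g'P -gP subrr.
exists k => x; apply: i_inj.
by rewrite kP /= pr_d_d linear0 subr0 f'P.
Qed.

Lemma cohomology_zero_iso (R : pzRingType) (M X Y : lmodType R)
    (P : projective_resolution M) (n : nat) :
  lmod_iso X Y -> cohomology_zero P n.+1 X -> cohomology_zero P n.+1 Y.
Proof.
move=> [f /linear_inverse[g [fK gK]]] h k kd.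
have [x|l lP] := h (g \o k); first by rewrite /= kd linear0.
by exists (f \o l) => x; rewrite /= -lP /= gK.
Qed.

(** The comparison theorem in lowest degrees: [a] and [b] lift the identity of [M] in both
    directions, [b1] continues [b] to degree 1, and [s] is a homotopy from the identity to [b \o a]
    in degree 0. *)
Lemma cohomology1_zero_indep (R : pzRingType) (M X : lmodType R)
    (P Q : projective_resolution M) :
  cohomology_zero Q 1 X -> cohomology_zero P 1 X.
Proof.
move=> h f fd.
have [a aP] := @pr_proj _ _ _ _ _ _ (pr_aug Q) (pr_aug P) (@pr_aug_surj _ _ Q).
have [b bP] := @pr_proj _ _ _ _ _ _ (pr_aug P) (pr_aug Q) (@pr_aug_surj _ _ P).
have [x|b1 b1P] :=
    projective_lift (p := pr_d P 0) (f := b \o pr_d Q 0) (@pr_proj _ _ Q 1).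
  by apply/pr_exact0; rewrite /= bP pr_d_aug.
have [x|s sP] :=
    projective_lift (p := pr_d P 0) (f := (b \o a) \- idfun) (@pr_proj _ _ P 0).
  by apply/pr_exact0; rewrite /= linearB bP aP subrr.
have f0 x : pr_d P 0 x = 0 -> f x = 0.
  by move=> /pr_exact[y <-].
have [x|g gP] := h (f \o b1).
  by apply: f0; rewrite b1P /= pr_d_d linear0.
exists ((g \o a) \- (f \o s)) => x /=.
(* Exactness of [Q] supplies [y] in place of an image of [x] under a chain map; [x] and
   [b1 y - s (pr_d P 0 x)] have the same differential, so [f] agrees on them by [f0]. *)
have [|y yP] := (pr_exact0 (a (pr_d P 0 x))).1; first by rewrite aP pr_d_aug.
rewrite -yP -gP /= -linearB.
apply/eqP; rewrite -subr_eq0 -linearB; apply/eqP/f0.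
rewrite !linearB b1P /= yP sP /=.
by rewrite opprK addKr subrr.
Qed.

(** * Cosyzygies *)

Lemma cosyzygy1_ses (R : pzRingType) (X C : lmodType R)
    (E : injective_coresolution X) (u : {linear C -> E 1%N}) :
    injective u ->
    (forall y, (exists c, u c = y) <-> exists x, ic_d E 0 x = y) ->
  exists p : {linear E 0%N -> C},
    [/\ forall x, u (p x) = ic_d E 0 x, surjective p & exact_at (ic_aug E) p].
Proof.
move=> u_inj uP; have [x|p pP] := factor_inj (f := ic_d E 0) u_inj.
  by apply/uP; exists x.
exists p; split=> // [c|x].
  have [|x xc] := (uP (u c)).1; first by exists c.
  by exists x; apply: u_inj; rewrite pP.
split=> [px|/ic_exact0 dx]; first by apply/ic_exact0; rewrite -pP px linear0.
by apply: u_inj; rewrite pP dx linear0.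
Qed.

Definition tail_coresolution (R : pzRingType) (X C : lmodType R)
    (E : injective_coresolution X) (u : {linear C -> E 1%N})
    (u_inj : injective u)
    (uP : forall y, (exists c, u c = y) <-> exists x, ic_d E 0 x = y) :
  injective_coresolution C.
Proof.
exists (fun i => E i.+1) (fun i => ic_d E i.+1) u => //.
- by move=> i; apply: ic_inj.
- by move=> y; rewrite uP; apply: ic_exact.
- by move=> i; apply: ic_exact.
Defined.

(** Shift once to the first cosyzygy of [X], then apply induction to the tail of [E], whose
    cosyzygies are those of [E] with the index lowered by one. *)
Lemma cohomology_zero_cosyzygy (R : pzRingType) (M X C : lmodType R)
    (P : projective_resolution M) (E : injective_coresolution X) (i : nat) :
    is_cosyzygy E i C ->
  cohomology_zero P i.+1 X <-> cohomology_zero P 1 C.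
Proof.
case: i => [CX|i].
  by split; apply: cohomology_zero_iso => //; apply: lmod_iso_sym.
elim: i X E => [|i IHi] X E.
  move=> [u [u_inj uP]]; have [p [_ p_surj ip]] := cosyzygy1_ses u_inj uP.
  by apply: cohomology_zero_shift ip => //; [apply: ic_inj | apply: ic_aug_inj].
have [K [u [u_inj imu]]] := lmod_sub (submodule_image (ic_d E 0)).
have uP y := iff_sym (imu y).
have [p [_ p_surj ip]] := cosyzygy1_ses u_inj uP.
move=> /(IHi _ (tail_coresolution u_inj uP)) <-.
by apply: cohomology_zero_shift ip => //; [apply: ic_inj | apply: ic_aug_inj].
Qed.

Lemma cosyzygy_exists (R : pzRingType) (X : lmodType R)
  (E : injective_coresolution X) (i : nat) : exists C, is_cosyzygy E i C.
Proof.
case: i => [|i]; first by exists X, idfun; exists id.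
have [K [u [u_inj imu]]] := lmod_sub (submodule_image (ic_d E i)).
by exists K, u; split=> // y; apply: iff_sym.
Qed.

Lemma Ext_zero_cosyzygy (R : pzRingType) (M X C : lmodType R)
    (E : injective_coresolution X) (i : nat) :
  is_cosyzygy E i C -> Ext_zero i.+1 M X <-> Ext_zero 1 M C.
Proof.
by move=> EC; split=> h P; apply/(cohomology_zero_cosyzygy P EC)/h.
Qed.

(** Passing to the [n]-th cosyzygy of [X] reduces the change of resolution to degree 1. *)
Lemma Ext_zero_cohomology (R : pzRingType) (I M X : lmodType R)
    (Q : projective_resolution M) (n : nat) :
    injective_module I -> cogenerator I ->
  cohomology_zero Q n.+1 X -> Ext_zero n.+1 M X.
Proof.
move=> injI cogI cohQ.
have [E] := injective_coresolution_exists X injI cogI.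
have [C EC] := cosyzygy_exists E n.
apply/(Ext_zero_cosyzygy M EC) => P.
exact/(cohomology1_zero_indep (Q := Q))/(cohomology_zero_cosyzygy Q EC).
Qed.

(** * Direct limits of injectives over coherent rings *)

(** The resolution is constructed to start with finitely generated free modules, which allows
    cochains to be lifted to a stage of the limit. Induction passes to syzygies until the cocycle
    sits in degree 1. *)
Lemma FP_cohomology_zero (R : pzRingType) (A : mod_class R) (n : nat)
    (M X : lmodType R) :
    subclass A (@injective_module R) -> FP n.+2 M -> dirlim A X ->
  exists P : projective_resolution M, cohomology_zero P n.+1 X.
Proof.
move=> A_inj FPM limX; elim: n M FPM => [|n IHn] M /FP_S[F0 [K]].
  move=> [u0 [e0 [F0_fg /FP_S[F1 [K' [u1 [e1]]]]]]].
  move=> [F1_fg /FP0P[F2 [e2 [F2_fg e2_surj]]] u1_inj e1_surj ue1].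
  move=> u0_inj e0_surj ue0; have [P] := projective_resolution_exists K'.
  exists (cons_resolution (fg_free_projective F0_fg) u0_inj e0_surj ue0
    (cons_resolution (fg_free_projective F1_fg) u1_inj e1_surj ue1 P)) => f fd.
  have fu1 x : f (u1 x) = 0 by have [z <-] := pr_aug_surj P x; apply: fd.
  have [d [J [S [dirJ AS /(direct_limitP dirJ)[c c_mod]]]]] := limX.
  have [j [g gP]] := fg_free_dirlim_lift f dirJ c_mod F1_fg.
  have [x|k [jk kP]] :=
    fg_free_dirlim_ker (f := g \o (u1 \o e2)) dirJ c_mod F2_fg.
    by rewrite /= gP.
  (* At stage [k] the lift kills the image of [F2], which is the kernel of [F1 -> F0], so
     injectivity of [S k] extends it to [F0]. *)
  have [x ux|h hP] := @injective_extend _ _ _ _ (u0 \o e1) (ds_map S jk \o g)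
    (A_inj _ (AS k)).
    have /ue1[y <-] : e1 x = 0 by rewrite (u0_inj (e1 x) 0) // linear0.
    by have [z <-] := e2_surj y; apply: kP.
  exists (c k \o h) => x; have [c_co _ _] := c_mod.
  by rewrite /= [h _]hP /= c_co gP.
move=> [u [e [F0_fg /IHn[P cohP] u_inj e_surj ue]]].
by exists (cons_resolution (fg_free_projective F0_fg) u_inj e_surj ue P).
Qed.

(** * Finitely generated submodules *)

(** The generators are hidden in a proposition, so that submodules with the same elements are equal
    and inclusion is antisymmetric. *)
Record fg_sub (R : pzRingType) (F : lmodType R) (L : F -> Prop) := FgSub {
  fg_sub_car :> F -> Prop;
  fg_subP : exists (k : nat) (v : {linear 'rV[R]_k -> F}),
    (forall w, L (v w)) /\ forall x, fg_sub_car x <-> exists w, v w = x }.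

HB.instance Definition _ (R : pzRingType) (F : lmodType R) (L : F -> Prop) :=
  gen_eqMixin (fg_sub L).
HB.instance Definition _ (R : pzRingType) (F : lmodType R) (L : F -> Prop) :=
  gen_choiceMixin (fg_sub L).

Definition fg_sub_le (R : pzRingType) (F : lmodType R) (L : F -> Prop) :
    rel (fg_sub L) :=
  fun A B => `[< forall x, A x -> B x >].

Lemma fg_sub_le_refl (R : pzRingType) (F : lmodType R) (L : F -> Prop) :
  reflexive (@fg_sub_le R F L).
Proof. by move=> A; apply/asboolP. Qed.

Lemma fg_sub_le_anti (R : pzRingType) (F : lmodType R) (L : F -> Prop) :
  antisymmetric (@fg_sub_le R F L).
Proof.
move=> [A AP] [B BP] /andP[/asboolP /= AB /asboolP /= BA].
have eAB : A = B.
  by apply/funext => x; apply/propext; split; [apply: AB|apply: BA].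
by subst B; congr FgSub; apply: Prop_irrelevance.
Qed.

Lemma fg_sub_le_trans (R : pzRingType) (F : lmodType R) (L : F -> Prop) :
  transitive (@fg_sub_le R F L).
Proof.
move=> B A C /asboolP AB /asboolP BC.
by apply/asboolP => x /AB; apply: BC.
Qed.

HB.instance Definition _ (R : pzRingType) (F : lmodType R) (L : F -> Prop) :=
  Order.Le_isPOrder.Build (Order.Disp tt tt) (fg_sub L)
    (@fg_sub_le_refl R F L) (@fg_sub_le_anti R F L) (@fg_sub_le_trans R F L).

Lemma fg_sub_leP (R : pzRingType) (F : lmodType R) (L : F -> Prop)
  (A B : fg_sub L) : (A <= B)%O <-> forall x, A x -> B x.
Proof. by split=> /asboolP. Qed.

Lemma fg_sub_submodule (R : pzRingType) (F : lmodType R) (L : F -> Prop)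
  (A : fg_sub L) : submodule A.
Proof.
have [k [v [_ vP]]] := fg_subP A; have [im0 imP] := submodule_image v.
by split=> [|a x y /vP Ax /vP Ay]; apply/vP; [apply: im0 | apply: imP].
Qed.

Definition fg_sub_image (R : pzRingType) (F : lmodType R) (L : F -> Prop)
    (k : nat) (v : {linear 'rV[R]_k -> F}) (Lv : forall w, L (v w)) :
    fg_sub L :=
  FgSub (ex_intro _ k (ex_intro _ v (conj Lv
    (fun x => iff_refl (exists w, v w = x))))).

Lemma fg_sub_directed (R : pzRingType) (F : lmodType R) (L : F -> Prop) :
  submodule L -> directed (fg_sub L).
Proof.
move=> subL; split.
  constructor; apply: (@fg_sub_image R F L 0 \0) => w; exact: subL.1.
move=> A B; have [k [v [Lv vP]]] := fg_subP A.
have [l [w [Lw wP]]] := fg_subP B.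
pose s : {linear 'rV[R]_(k + l) -> F} := (v \o lsubmx) \+ (w \o rsubmx).
have Ls x : L (s x) by apply: submoduleD subL (Lv _) (Lw _).
exists (fg_sub_image Ls); split; apply/fg_sub_leP => x /=.
  by move=> /vP[y <-]; exists (row_mx y 0);
    rewrite /= row_mxKl row_mxKr linear0 addr0.
by move=> /wP[y <-]; exists (row_mx 0 y);
  rewrite /= row_mxKl row_mxKr linear0 add0r.
Qed.

Lemma fg_sub_mem (R : pzRingType) (F : lmodType R) (L : F -> Prop) x :
  submodule L -> L x -> exists A : fg_sub L, A x.
Proof.
move=> subL Lx; have [v vP] := @rV_extend R 1 F (fun=> x).
have Lv w : L (v w).
  rewrite (row_sum_delta w) big_ord1 linearZ /= vP.
  exact: submoduleZ.
by exists (fg_sub_image Lv), (delta_mx 0 0); rewrite vP.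
Qed.

(** The quotients of [F] by the finitely generated submodules inside [L]; surjectivity of the
    projections forces the functor laws. *)
Lemma fg_quotient_system (R : pzRingType) (F : lmodType R) (L : F -> Prop) :
  exists (S : direct_system R (fg_sub L)) (p : forall A, {linear F -> S A}),
    [/\ forall A, surjective (p A), forall A x, p A x = 0 <-> A x
      & forall A B (le_AB : (A <= B)%O) x, ds_map S le_AB (p A x) = p B x].
Proof.
have quot_ex (A : fg_sub L) := lmod_quotient (fg_sub_submodule A).
pose Q A := sval (cid (quot_ex A)).
pose p A : {linear F -> Q A} := sval (cid (svalP (cid (quot_ex A)))).
have [p_surj pP] :
    (forall A, surjective (p A)) /\ forall A x, p A x = 0 <-> A x.
  by split=> A; have [] := svalP (cid (svalP (cid (quot_ex A)))).
have map_ex (A B : fg_sub L) (le_AB : (A <= B)%O) :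
    exists g : {linear Q A -> Q B}, forall x, g (p A x) = p B x.
  apply: factor_surj => // x /pP Ax; apply/pP.
  by move/fg_sub_leP: le_AB; apply.
have @S : direct_system R (fg_sub L).
  exists Q (fun A B le_AB => sval (cid (map_ex A B le_AB))) => [A le_AA q|].
    by have [x <-] := p_surj A q; case: cid.
  move=> A B C le_AB le_BC le_AC q; have [x <-] := p_surj A q.
  case: cid => f fP; case: cid => g gP; case: cid => h hP /=.
  by rewrite gP fP hP.
by exists S, p; split=> // A B le_AB x /=; case: cid.
Qed.

(** * The functorial power of [I] indexed by Hom(M, I), and evaluation into it *)

Definition hom_power (R : pzRingType) (I M : lmodType R) : lmodType R :=
  {linear M -> I} -> I.

Lemma hom_power_eval_linear (R : pzRingType) (I M : lmodType R) :
  linear (fun x (h : {linear M -> I}) => h x : I).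
Proof. by move=> a x y; apply/funext => h; rewrite linearP. Qed.

Definition hom_power_eval (R : pzRingType) (I M : lmodType R) :
    {linear M -> hom_power I M} :=
  linear_map (@hom_power_eval_linear R I M).

Lemma hom_power_map_linear (R : pzRingType) (I M N : lmodType R)
    (f : {linear M -> N}) :
  linear (fun (phi : hom_power I M) (h : {linear N -> I}) => phi (h \o f) : I).
Proof. by []. Qed.

(** Reindexing along precomposition with [f] makes the power covariant in the module, and evaluation
    natural. *)
Definition hom_power_map (R : pzRingType) (I M N : lmodType R)
    (f : {linear M -> N}) : {linear hom_power I M -> hom_power I N} :=
  linear_map (@hom_power_map_linear R I M N f).

Definition hom_power_system (R : pzRingType) (I : lmodType R)
    (d : Order.disp_t) (J : porderType d) (S : direct_system R J) :
  direct_system R J.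
Proof.
exists (fun j => hom_power I (S j))
  (fun i j le_ij => hom_power_map I (ds_map S le_ij)).
  move=> i le_ii phi; apply/funext => h /=.
  by congr (phi _); apply: linear_eq => x /=; rewrite ds_map_id.
move=> i j k le_ij le_jk le_ik phi; apply/funext => h /=.
by congr (phi _); apply: linear_eq => x /=; rewrite (ds_map_comp _ _ le_ik).
Defined.

(** * Coherence from vanishing of Ext *)

Lemma FP2_of_Ext1_zero (R : pzRingType) (I M : lmodType R) :
    cogenerator I -> FP 1 M ->
    (forall X, dirlim (hom_powers I) X -> Ext_zero 1 M X) ->
  FP 2 M.
Proof.
move=> cogI /FP_S[F0 [K [u [e]]]].
move=> [F0_fg /FP0P[F1 [q [F1_fg q_surj]]] u_inj e_surj ue] extM.
apply/FP_S; exists F0, K, u, e; split=> //.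
pose L x := q x = 0; have subL : submodule L by apply: submodule_ker.
have [S [p [p_surj pP Sp]]] := fg_quotient_system L.
pose T := hom_power_system I S; have dirL := fg_sub_directed subL.
have [X [c c_mod]] := dirlim_model_exists T dirL; have [c_co _ _] := c_mod.
have limX : dirlim (hom_powers I) X.
  exists _, (fg_sub L), T; split=> //; last exact: dirlim_model_limit c_mod.
  by move=> A; exists (S A), idfun; exists id.
pose ev A : {linear F1 -> T A} := hom_power_eval I (S A) \o p A.
have evS A B (le_AB : (A <= B)%O) x : ds_map T le_AB (ev A x) = ev B x.
  by rewrite [RHS]/= -(Sp A B le_AB x).
(* Evaluation is injective because [I] is a cogenerator, so [ev A] has the same kernel as [p A]. *)
have ev0 A x : ev A x = 0 <-> A x.
  rewrite -pP; split=> [evx|px]; last first.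
    by apply/funext => h; rewrite /= px linear0.
  by apply: (cogenerator_separates cogI) => h; have := congr1 (@^~ h) evx.
have c_ev A B x : c A (ev A x) = c B (ev B x).
  by have [D [AD BD]] := dirL.2 A B; rewrite -(c_co _ _ AD) -(c_co _ _ BD) !evS.
have [[A0] _] := dirL.
(* By [c_ev] the map [F1 -> X] is the same for every index; it kills each element of [L], as seen at
   an index containing that element, and so descends to [K]. *)
have [x Lx|k kP] := @factor_surj _ _ _ _ q (c A0 \o ev A0) q_surj.
  have [A Ax] := fg_sub_mem subL Lx.
  by rewrite [LHS](c_ev A0 A) (ev0 A x).2 // linear0.
have [g gP] := Ext1_zero_extend k (fg_free_projective F0_fg) u_inj e_surj ue
  (extM X limX).
have [A [f fP]] := fg_free_dirlim_lift g dirL c_mod F0_fg.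
(* Both maps [F1 -> T A] induce the same map to [X], hence agree at a later stage [B]. There the
   first one kills [L], so [ev B] does too, which puts [L] inside [B]. *)
have [x|B [AB BP]] := fg_free_dirlim_ker (f := (f \o (u \o q)) \- ev A)
  dirL c_mod F1_fg.
  have guq : g (u (q x)) = c A (ev A x) by rewrite gP kP; apply: c_ev.
  by rewrite linearB fP [g _]guq subrr.
have BL x : L x -> B x.
  move=> Lx; apply/ev0; have := BP x.
  rewrite linearB evS /= Lx !linear0 sub0r => /eqP.
  by rewrite oppr_eq0 => /eqP.
have [K' [v [v_inj vP]]] := lmod_sub subL.
apply/FP_S; exists F1, K', v, q; split=> //.
have [m [w [Lw wP]]] := fg_subP B.
have [x|w' w'P] := factor_inj (f := w) v_inj; first exact/vP.
apply/FP0P; exists 'rV[R]_m, w'; split; first by exists m, idfun; exists id.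
move=> y; have /BL/wP[x xy] : L (v y) by apply/vP; exists y.
by exists x; apply: v_inj; rewrite w'P.
Qed.

(** The Ext condition and the presentation length both drop by one on the first syzygy, down to the
    case of Ext^1. *)
Lemma FP_of_Ext_zero (R : pzRingType) (I M : lmodType R) (n : nat) :
    cogenerator I -> FP n.+1 M ->
    (forall X, dirlim (hom_powers I) X -> Ext_zero n.+1 M X) ->
  FP n.+2 M.
Proof.
move=> cogI; elim: n M => [|n IHn] M FPM extM.
  exact: FP2_of_Ext1_zero extM.
have [F [K [u [e [F_fg FPK u_inj e_surj ue]]]]] := (FP_S _ _).1 FPM.
apply/FP_S; exists F, K, u, e; split=> //; apply: IHn => // X limX.
apply: Ext_zero_syzygy u_inj e_surj ue _; first exact: fg_free_projective.
exact: extM.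
Qed.

Theorem theorem26 (R : pzRingType) (n : nat) (hn : (0 < n)%N)
    (I : lmodType R) (hinj : injective_module I) (hcog : cogenerator I) :
  (left_coherent R n <->
     (forall M X : lmodType R,
        FP n M -> dirlim (hom_powers I) X -> Ext_zero n M X)) /\
  (left_coherent R n <->
     subclass (cosyzygies n.-1 (dirlim (hom_powers I))) (@FP_Inj R n)).
Proof.
(* With [n.+1] in place of [n], the cosyzygy index becomes [n], matching the shift from Ext^(n+1) to
   Ext^1. *)
case: n hn => // n _ /=.
have coh_ext : left_coherent R n.+1 <-> (forall M X : lmodType R,
    FP n.+1 M -> dirlim (hom_powers I) X -> Ext_zero n.+1 M X).
  split=> [coh M X FPM limX|ext M FPM].
    have [|P cohP] := FP_cohomology_zero _ (coh _ FPM) limX.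
      move=> Y [N YN]; apply: lmod_iso_injective YN _.
      exact: (power_injective hinj).
    exact: Ext_zero_cohomology hinj hcog cohP.
  by apply: (FP_of_Ext_zero hcog FPM) => X; apply: ext FPM.
split=> //; rewrite coh_ext; split=> [ext C [X [E [limX EC]]] M|inj M X] FPM.
  by apply/(Ext_zero_cosyzygy M EC)/ext.
move=> limX; have [E] := injective_coresolution_exists X hinj hcog.
have [C EC] := cosyzygy_exists E n.
by apply/(Ext_zero_cosyzygy M EC)/inj => //; exists X, E.
Qed.
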